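(* Let $n\ge 1$ and let $G_n^+=\overline{L_n}$ be the graph complement of the path graph $L_n$ with vertices $1,2,\dots,n$ (consecutive integers adjacent in $L_n$). Define polynomials by $f_{-1}^+(t)=f_0^+(t)=1$ and $f_m^+(t)=f_{m-1}^+(t)+t f_{m-2}^+(t)$ for $m\ge 1$. Then for every $1\le k\le n$ the Euler-Levitt curvature $K_n(k)$ of $G_n^+$ at the vertex $k$ is $$K_n(k)=\int_{-1}^{0} f_{k-2}^+(t)\,f_{n-k-1}^+(t)\;dt.$$
   Context: For a vertex $x$ of a finite simple graph, the unit sphere $S(x)$ is the subgraph induced by the neighbors of $x$, and the Euler-Levitt curvature at $x$ is $K(x)=1+\sum_{j\ge 0}(-1)^{j+1}\frac{f_j(S(x))}{j+2}$, where $f_j(S(x))$ is the number of complete subgraphs $K_{j+1}$ in $S(x)$. *)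

(* Defs.v *)
From HB Require Import structures.
From mathcomp Require Import all_boot all_order all_algebra.
From mathcomp Require Import all_classical all_reals all_analysis.

Set Implicit Arguments.
Unset Strict Implicit.
Unset Printing Implicit Defensive.

Import Order.TTheory GRing.Theory Num.Theory.
Local Open Scope ring_scope.

Record sgraph := SGraph {
  vertex :> finType;
  adj : rel vertex;
  adj_sym : symmetric adj;
  adj_irrefl : irreflexive adj
}.

Section SimpleGraphs.
Variable G : sgraph.
Implicit Types (x y : G) (S : {set G}) (A : {set G}).

Definition compl_adj : rel G := fun x y => (x != y) && ~~ adj x y.

Lemma compl_adj_sym : symmetric compl_adj.
Proof. by move=> x y; rewrite /compl_adj eq_sym adj_sym. Qed.

Lemma compl_adj_irrefl : irreflexive compl_adj.
Proof. by move=> x; rewrite /compl_adj eqxx. Qed.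

Definition compl_graph : sgraph := SGraph compl_adj_sym compl_adj_irrefl.

Definition induced_adj S : rel {x : G | x \in S} :=
  fun u v => adj (val u) (val v).

Lemma induced_adj_sym S : symmetric (@induced_adj S).
Proof. by move=> u v; rewrite /induced_adj adj_sym. Qed.

Lemma induced_adj_irrefl S : irreflexive (@induced_adj S).
Proof. by move=> u; rewrite /induced_adj adj_irrefl. Qed.

Definition induced S : sgraph :=
  SGraph (@induced_adj_sym S) (@induced_adj_irrefl S).

Definition unit_sphere x : sgraph := induced [set y | adj x y].

Definition clique A : bool :=
  [forall x in A, forall y in A, (x != y) ==> adj x y].

(* number of complete subgraphs K_(j+1), i.e. of j-dimensional simplices *)
Definition fvec (j : nat) : nat :=
  #|[set A : {set G} | clique A & #|A| == j.+1]|.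

End SimpleGraphs.

(* The sum over all j >= 0 is cut at the order of the unit sphere, past which
   fvec vanishes. *)
Definition curvature (R : numFieldType) (G : sgraph) (x : G) : R :=
  1 + \sum_(j < #|unit_sphere x|)
        (-1) ^+ j.+1 * ((fvec (unit_sphere x) j)%:R / (j.+2)%:R).

Lemma fvec_eq0 (G : sgraph) (j : nat) : (#|G| <= j)%N -> fvec G j = 0%N.
Proof.
move=> le_Gj; apply/eqP; rewrite cards_eq0; apply/eqP/setP => A.
rewrite !inE; apply/negbTE; rewrite negb_and; apply/orP; right.
by rewrite neq_ltn ltnS (leq_trans (max_card _) le_Gj).
Qed.

Section PathGraph.
Variable n : nat.

Definition path_adj : rel 'I_n :=
  fun i j => (i.+1 == j :> nat) || (j.+1 == i :> nat).

Lemma path_adj_sym : symmetric path_adj.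
Proof. by move=> i j; rewrite /path_adj orbC. Qed.

Lemma path_adj_irrefl : irreflexive path_adj.
Proof. by move=> i; rewrite /path_adj orbb gtn_eqF. Qed.

Definition path_graph : sgraph := SGraph path_adj_sym path_adj_irrefl.

Definition Gplus : sgraph := compl_graph path_graph.

(* The vertices are numbered 1, ..., n, whereas 'I_n starts at 0. *)
Definition label (v : Gplus) : nat := (nat_of_ord v).+1.

Lemma label_inj : injective label.
Proof. by move=> u v /succn_inj /ord_inj. Qed.

Lemma label_surj (k : nat) :
  (1 <= k <= n)%N -> exists v : Gplus, label v = k.
Proof. by case: k => // k /= lt_kn; exists (Ordinal lt_kn). Qed.

End PathGraph.

(* fplus_shift j is the polynomial of index j - 1. *)
Fixpoint fplus_shift (R : comNzRingType) (j : nat) : {poly R} :=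
  match j with
  | j1.+1 => match j1 with
             | j2.+1 => fplus_shift R j1 + 'X * fplus_shift R j2
             | 0 => 1
             end
  | 0 => 1
  end.

(* Only indices m >= -1 are meaningful. *)
Definition fplus (R : comNzRingType) (m : int) : {poly R} :=
  fplus_shift R (absz (m + 1)).

Lemma fplusN1 (R : comNzRingType) : fplus R (-1) = 1.
Proof. by []. Qed.

Lemma fplus0 (R : comNzRingType) : fplus R 0 = 1.
Proof. by []. Qed.

Lemma fplus_rec (R : comNzRingType) (m : int) :
  1 <= m -> fplus R m = fplus R (m - 1) + 'X * fplus R (m - 2).
Proof.
case: m => [[|m]|m] // _; rewrite /fplus.
have -> : absz (Posz m.+1 + 1) = m.+2 by rewrite -PoszD addn1.
have -> : absz (Posz m.+1 - 1 + 1) = m.+1 by rewrite subrK.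
have -> : absz (Posz m.+1 - 2 + 1) = m; last by [].
by rewrite -addn1 PoszD -!addrA (_ : 1 + (- 2 + 1) = 0 :> int) ?addr0.
Qed.

(* Main.v *)
Require Import Defs.
From mathcomp Require Import all_boot all_order all_algebra.
From mathcomp Require Import all_classical all_reals all_analysis.
From mathcomp Require Import zify.

Set Implicit Arguments.
Unset Strict Implicit.
Unset Printing Implicit Defensive.

Import Order.TTheory GRing.Theory Num.Theory.
Import numFieldNormedType.Exports.
Local Open Scope ring_scope.

(** For a set [S] of vertices let [clique_poly S] be the sum of [t ^ |A|] over
    all cliques [A] inside [S], the empty one included.

    The integral of [t ^ m] over [-1, 0] is [(-1) ^ m / (m + 1)], which is
    exactly the weight that the Euler-Levitt curvature gives to a clique with
    [m] vertices of the unit sphere; the leading 1 is the weight of the empty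
    clique.  Hence the curvature of any graph at [x] is the integral over
    [-1, 0] of the clique polynomial of the neighbourhood of [x]
    ([curvature_integral]).

    It remains to compute this polynomial in the complement of a path.
    Splitting the cliques in [S] according to whether they contain a given
    vertex [x] gives
      [clique_poly S = clique_poly (S :\ x) + t * clique_poly (S :&: N(x))]
    ([clique_poly_delete]).  When [x] is the last vertex of a run of
    consecutive integers, passing to [N(x)] removes [x] and the integer
    before it, so the lengths [d] of the run obey the recursion of [fplus].
    Vertices separated from the run by a gap are adjacent to all of it, hence
    contribute an independent factor ([clique_poly_run]).  The neighbours of [k]
    are the runs [1 .. k - 2] and [k + 2 .. n], and using the lemma for each
    of them yields the product of the two polynomials
    ([clique_poly_sphere]). *)

Section CliquePolynomial.
Import boot.fintype boot.finset.
Variables (R : comNzRingType) (G : sgraph).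
Implicit Types (x y : G) (A B S : {set G}).

Lemma cliqueP A :
  reflect {in A &, forall x y, x != y -> adj x y} (clique A).
Proof.
apply: (iffP forall_inP) => [clA x y xA yA|clA x xA].
  by move/forall_inP: (clA x xA) => /(_ y yA) /implyP.
by apply/forall_inP => y yA; apply/implyP; exact: clA.
Qed.

Lemma clique_setU1 x B : x \notin B ->
  clique (x |: B) = clique B && (B \subset [set y | adj x y]).
Proof.
move=> xB; apply/cliqueP/andP => [cl|[/cliqueP cl /subsetP sB] y z].
  split.
    by apply/cliqueP => y z yB zB; apply: cl; rewrite in_setU1 ?yB ?zB orbT.
  apply/subsetP => y yB; rewrite inE; apply: cl.
  - exact: setU11.
  - exact: setU1r.
  - by apply: contraNneq xB => ->.
rewrite !in_setU1 => /predU1P[->|yB] /predU1P[->|zB]; rewrite ?eqxx //.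
- by have := sB z zB; rewrite inE.
- by have := sB y yB; rewrite inE adj_sym.
- exact: cl.
Qed.

Definition clique_poly S : {poly R} :=
  \sum_(A : {set G} | clique A && (A \subset S)) 'X^#|A|.

Lemma clique_poly0 : clique_poly set0 = 1.
Proof.
rewrite /clique_poly (big_pred1 set0) ?cards0 ?expr0 // => A.
rewrite subset0 andbC /=; case: eqP => //= ->.
by apply/cliqueP => x y; rewrite in_set0.
Qed.

(** The cliques in [S] that contain [x] are the sets [x |: B] with [B] a clique
    among the neighbours of [x] in [S]. *)
Lemma clique_poly_delete x S : x \in S ->
  clique_poly S =
  clique_poly (S :\ x) + 'X * clique_poly [set y in S | adj x y].
Proof.
move=> xS; rewrite /clique_poly (bigID (fun A => x \notin A)) /=.
congr (_ + _); first by apply: eq_bigl => A; rewrite subsetD1 andbA.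
rewrite mulr_sumr (reindex_onto (fun B => x |: B) (fun A => A :\ x)) /=; last first.
  by move=> A /andP[_]; rewrite negbK => /setD1K.
apply: eq_big => [B|B].
  rewrite setU11 andbT subUset sub1set xS /=.
  have [xB|xB] := boolP (x \in B).
    rewrite [_ == B](_ : _ = false); last first.
      by apply/eqP => e; have := congr1 (fun A : {set G} => x \in A) e; rewrite !inE eqxx xB.
    rewrite andbF; apply/esym/negbTE; rewrite negb_and; apply/orP; right.
    by apply/negP => /subsetP/(_ x xB); rewrite inE adj_irrefl andbF.
  rewrite setU1K // eqxx andbT clique_setU1 // -andbA; congr (_ && _).
  by rewrite setIdE subsetI andbC.
case/andP=> _ /eqP e; have xB : x \notin B by rewrite -e !inE eqxx.
by rewrite cardsU1 xB exprS.
Qed.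

Lemma coef_clique_poly S i :
  (clique_poly S)`_i = (#|[set A | clique A && (A \subset S) & #|A| == i]|)%:R.
Proof.
rewrite coef_sum -sum1_card natr_sum big_mkcond [RHS]big_mkcond.
apply: eq_bigr => A _; rewrite inE coefXn eq_sym.
by case: (clique A && _); case: eqP.
Qed.

Lemma size_clique_poly S : (size (clique_poly S) <= #|G|.+1)%N.
Proof.
apply: (leq_trans (size_sum _ _ _)); apply/bigmax_leqP => A _.
by rewrite size_polyXn ltnS max_card.
Qed.

End CliquePolynomial.

Section InducedSubgraph.
Import boot.fintype boot.finset.

(** The unit sphere is a graph on a subtype; this brings its cliques back to
    sets of vertices of the ambient graph, where deletion can be iterated. *)
Lemma clique_poly_induced (R : comNzRingType) (G : sgraph) (S : {set G}) :
  clique_poly R [set: Defs.induced S] = clique_poly R S.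
Proof.
have injv : injective (val : Defs.induced S -> G) by exact: val_inj.
rewrite /clique_poly [RHS](reindex_onto (fun A : {set Defs.induced S} => val @: A)
  (fun A => val @^-1: A)) /=; last first.
  move=> A /andP[_ /subsetP sA]; apply/setP => x; apply/imsetP/idP.
    by case=> u; rewrite inE => uA ->.
  by move=> xA; exists (Sub x (sA x xA)); rewrite ?inE SubK.
apply: eq_big => [A|A _]; last by rewrite card_imset.
have -> : val @^-1: (val @: A) = A by apply/setP => u; rewrite inE mem_imset.
rewrite subsetT eqxx !andbT.
have -> : val @: A \subset S.
  by apply/subsetP => _ /imsetP[u _ ->]; exact: valP.
rewrite andbT; apply/cliqueP/cliqueP => cl.
  move=> _ _ /imsetP[u uA ->] /imsetP[w wA ->] ne.
  by apply: (cl u w uA wA); apply: contraNneq ne => ->.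
move=> u w uA wA ne; apply: (cl (val u) (val w)); rewrite ?imset_f //.
Qed.

End InducedSubgraph.

Section Integral.
Import boot.fintype boot.finset.
Variable R : realType.
Local Notation mu := (@lebesgue_measure R).

Lemma Rintegral_deriv_poly (q : {poly R}) (a b : R) : a < b ->
  \int[mu]_(t in `[a, b]) q^`().[t] = q.[b] - q.[a].
Proof.
move=> ab; rewrite /Rintegral (@continuous_FTC2 _ _ (horner q)) //=.
- by apply: continuous_subspaceT => x; exact: continuous_horner.
- split => [x _||]; first exact: derivable_horner.
  + by apply: cvg_at_right_filter; exact: continuous_horner.
  + by apply: cvg_at_left_filter; exact: continuous_horner.
- by move=> x _; rewrite derivE.
Qed.

(** The bound [m] is free so that the sum can be matched with one cut at the
    number of vertices of a graph, whatever the degree of [p]. *)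
Lemma Rintegral_poly_N10 (p : {poly R}) (m : nat) : (size p <= m)%N ->
  \int[mu]_(t in `[(-1 : R), (0 : R)]) p.[t] =
  \sum_(i < m) (-1) ^+ i * (p`_i / i.+1%:R).
Proof.
move=> le_pm; pose q : {poly R} := \sum_(i < m) (p`_i / i.+1%:R) *: 'X^(i.+1).
have qp : q^`() = p.
  rewrite /q raddf_sum /= -[RHS](take_poly_id le_pm) /take_poly poly_def.
  apply: eq_bigr => i _; rewrite derivZ derivXn /= -scalerMnr scalerMnl.
  by rewrite -[_ *+ i.+1]mulr_natr divfK // pnatr_eq0.
transitivity (\int[mu]_(t in `[(-1 : R), (0 : R)]) q^`().[t]); first by rewrite qp.
rewrite Rintegral_deriv_poly ?oppr_lt0 // !horner_sum -sumrB.
apply: eq_bigr => i _.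
rewrite !hornerE expr0n mulr0 sub0r exprS mulN1r mulrN opprK mulrC.
by rewrite mulrA.
Qed.

(** Each clique with [m] vertices in the sphere, the empty one included, has
    weight [(-1) ^ m / (m + 1)] on both sides. *)
Lemma curvature_integral (G : sgraph) (x : G) :
  curvature R x =
  \int[mu]_(t in `[(-1 : R), (0 : R)]) (clique_poly R [set y | adj x y]).[t].
Proof.
rewrite -clique_poly_induced -/(unit_sphere x).
rewrite (Rintegral_poly_N10 (size_clique_poly _ _)) big_ord_recl /= expr0 mul1r divr1.
rewrite coef_clique_poly; congr (_ + _).
  rewrite (_ : [set _ | _] = [set set0]) ?cards1 //.
  apply/setP => A; rewrite !inE cards_eq0 andbC; case: eqP => //= ->.
  by rewrite subsetT andbT; apply/cliqueP => u w; rewrite inE.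
apply: eq_bigr => j _; rewrite coef_clique_poly /fvec; congr (_ * (_%:R / _)).
by apply: eq_card => A; rewrite !inE subsetT andbT.
Qed.

End Integral.

Section ComplementOfPath.
Import boot.fintype boot.finset.
Variables (R : comNzRingType) (n : nat).
Implicit Types (B : {set Gplus n}).

Lemma adj_Gplus (i j : Gplus n) :
  adj i j = [&& i != j :> nat, i.+1 != j & j.+1 != i].
Proof. by rewrite /= /compl_adj /= /path_adj negb_or. Qed.

(** The run [c, ..., c + d - 2] has [d - 1] vertices (none if [d <= 1]): this
    shift matches the indexing of [fplus_shift], and for [d = 0] it gives the
    value 1 that stands for the index [-1].  The bound on [B] leaves a gap
    before [c], so that every vertex of [B] is adjacent to the run.  In the
    induction the last vertex [c + d] of the run for [d + 2] is deleted. *)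
Lemma clique_poly_run B (c d : nat) :
  (forall x, x \in B -> (x.+1 < c)%N) -> (c + d <= n.+1)%N ->
  clique_poly R (B :|: [set j : Gplus n | (c <= j)%N && (j.+1 < c + d)%N]) =
  clique_poly R B * fplus_shift R d.
Proof.
move=> ltBc; elim/ltn_ind: d => -[|[|d]] IH le_cdn.
- rewrite mulr1; congr clique_poly; apply/setP => j; rewrite !inE. lia.
- rewrite mulr1; congr clique_poly; apply/setP => j; rewrite !inE. lia.
have lt_cdn : (c + d < n)%N by lia.
rewrite (@clique_poly_delete _ (Gplus n) (Ordinal lt_cdn)); last by rewrite !inE /=; lia.
have -> : fplus_shift R d.+2 = fplus_shift R d.+1 + 'X * fplus_shift R d by [].
rewrite mulrDr mulrCA -!IH; try lia.
congr (_ + _ * _); congr clique_poly; apply/setP => j; rewrite !inE.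
- rewrite -val_eqE /=; have := ltBc j; case: (j \in B) => [/(_ isT)|_]; lia.
- rewrite adj_Gplus /=; have := ltBc j; case: (j \in B) => [/(_ isT)|_]; lia.
Qed.

Lemma clique_poly_sphere (v : Gplus n) :
  clique_poly R [set j | adj v j] =
  fplus_shift R v * fplus_shift R (n - v.+1).
Proof.
have lt_vn := ltn_ord v.
pose B := [set j : Gplus n | (j.+1 < v)%N].
(* the left run, started at 0 over the empty set *)
have <- : clique_poly R B = fplus_shift R v.
  have := @clique_poly_run set0 0 v; rewrite clique_poly0 mul1r.
  rewrite set0U => <- //; last by lia.
  by move=> x; rewrite inE.
(* the right run, started two places after v over the left one *)
rewrite -(@clique_poly_run B v.+2); last by lia.
  congr clique_poly; apply/setP => j; rewrite !inE -/(adj v j) adj_Gplus.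
  have := ltn_ord j. lia.
by move=> x; rewrite inE; lia.
Qed.

End ComplementOfPath.

Theorem theorem10 (R : realType) (n : nat) (hn : (1 <= n)%N)
    (k : nat) (hk : (1 <= k <= n)%N) (v : Gplus n) (hv : label v = k) :
  curvature R v =
  \int[@lebesgue_measure R]_(t in `[(-1 : R), (0 : R)])
     ((fplus R (k%:Z - 2)).[t] * (fplus R (n%:Z - k%:Z - 1)).[t]).
Proof.
rewrite curvature_integral clique_poly_sphere -{k}hv /label in hk *.
rewrite /fplus; have -> : absz ((v.+1)%:Z - 2 + 1) = v by lia.
have -> : absz (n%:Z - (v.+1)%:Z - 1 + 1) = (n - v.+1)%N by lia.
by congr Rintegral; apply/funext => t; rewrite hornerM.
Qed.
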